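(* Let $q > 2$ be a power of $2$ and let $x$ be a primitive element of $GF(q^2)$. Let $\mathcal{X} = \mathrm{Sprott}(q^2,q+2)$, formed using $x$. Let $$S_{0,0} = \{ \{0, x^i, x^{i+(q-1)},x^{i+2(q-1)}, \dots, x^{i+q(q-1)}\} \mid 0 \leq i \leq q-2 \}$$ be the set of base blocks. For $0 \leq j \leq q$, let $$S_{0,j+1} = \{ x^{j+(q+1)i} \cdot \{0, 1, x^{q-1}+1,x^{2(q-1)}+1, \dots, x^{q(q-1)}+1 \} \mid 0 \leq i \leq q-2 \}.$$ Let $X_0 = \{ S_{0,i} \mid 0 \leq i \leq q+1 \}$. For $v \in GF(q^2)$, let $X_v = X_0 + v$ be the translation of $X_0$ by $v$ (every block of every class is translated by $v$). Let $\mathcal{C} = \{ X_v \mid v \in GF(q^2) \}$. Then $\mathcal{C}$ is a local resolution system for $\mathcal{X}$, it is the only local resolution system for $\mathcal{X}$, and $\mathcal{C}$ is non-triangular.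
   Context: **BIBDs.** A BIBD$(v,k,\lambda)$, with $k<v$, is a pair $(\mathcal{P},\mathcal{B})$ where $\mathcal{P}$ is a set of $v$ points and $\mathcal{B}$ is a family (multiset; repeated blocks allowed, and regarded as distinct members) of $k$-subsets of $\mathcal{P}$, called blocks, such that every 2-subset of $\mathcal{P}$ is contained in exactly $\lambda$ blocks. **The Sprott design.** Let $p$ be a prime and let $m,\lambda$ satisfy $m(\lambda-1)=p^a-1$. Let $x$ be a primitive element of $GF(p^a)$ (a generator of its multiplicative group). The base blocks are the $m$ sets $\{0, x^i, x^{i+m}, x^{i+2m},\dots,x^{i+(\lambda-2)m}\}$, $0\le i\le m-1$. They form a difference family (a known result of Sprott), and $\mathrm{Sprott}(p^a,\lambda)$ denotes the associated BIBD$(p^a,\lambda,\lambda)$: its point set is $GF(p^a)$ and its blocks are all translates $B+v$ of the base blocks $B$ by elements $v\in GF(p^a)$. For $\mathrm{Sprott}(q^2,q+2)$ one has $m=q-1$. **Notation.** For $c$ in the field and a set $B$, $c\cdot B=\{cb\mid b\in B\}$ and $B+v=\{b+v\mid b\in B\}$. **Local resolutions.** A parallel class about a point $p\in\mathcal{P}$ is a set $S$ of blocks containing $p$ such that $\{b-\{p\} \mid b\in S\}$ is a partition of $\mathcal{P}-\{p\}$. A local resolution about $p$ is a partition of the family of all blocks containing $p$ into parallel classes about $p$. A local resolution system is a collection $\{X_p \mid p\in\mathcal{P}\}$ with $X_p$ a local resolution about $p$, for every point $p$. **Non-triangular.** A local resolution system $\{X_p\}$ is non-triangular if for any three distinct blocks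 $b,c,d$: if $b$ and $c$ are in a common parallel class about $p$ (a member of $X_p$), and $b$ and $d$ are in a common parallel class about $q'$, for some points $p\neq q'$, then $c$ and $d$ are not in a common parallel class about $r$ for any point $r\in\mathcal{P}$. *)

(* Defs.v *)
From mathcomp Require Import all_boot all_order all_algebra all_fingroup.
From mathcomp Require Import all_solvable finfield ring.

Set Implicit Arguments.
Unset Strict Implicit.
Unset Printing Implicit Defensive.

Import GRing.Theory.
Local Open Scope ring_scope.

(* A family (multiset) of blocks on the point type P is an indexed family
   blk : I -> {set P}. The members of the family are the indices, so repeated
   blocks are distinct members, and "a set of blocks" is a {set I}. *)

Section Designs.
Variables (P I : finType) (blk : I -> {set P}).

Definition is_bibd (v k l : nat) : Prop :=
  [/\ (k < v)%N, #|P| = v, forall b : I, #|blk b| = k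
    & forall A : {set P}, #|A| = 2 -> #|[set b | A \subset blk b]| = l].

Definition blocks_at (p : P) : {set I} := [set b | p \in blk b].

(* The partition is one of the family b - {p}, b in S: [partition] only sees
   the set of those subsets, so injectivity on S is required separately. *)
Definition parallel_class (p : P) (S : {set I}) : Prop :=
  [/\ S \subset blocks_at p,
      {in S &, injective (fun b => blk b :\ p)}
    & partition [set blk b :\ p | b in S] [set~ p]].

Definition local_resolution (p : P) (X : {set {set I}}) : Prop :=
  partition X (blocks_at p) /\ (forall S, S \in X -> parallel_class p S).

Definition local_resolution_system (X : P -> {set {set I}}) : Prop :=
  forall p, local_resolution p (X p).

Definition in_common_class (X : P -> {set {set I}}) (p : P) (b c : I) : Prop :=
  exists2 S, S \in X p & (b \in S) && (c \in S).

Definition non_triangular (X : P -> {set {set I}}) : Prop :=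
  forall b c d : I, b != c -> b != d -> c != d ->
  forall p p' : P, p != p' ->
    in_common_class X p b c -> in_common_class X p' b d ->
  forall r : P, ~ in_common_class X r c d.

(* Classes given as sets of subsets of P, read as sets of family members: S
   stands for all the indices b with blk b in S. *)
Definition members (X : {set {set {set P}}}) : {set {set I}} :=
  [set blk @^-1: (S : {set {set P}}) | S : {set {set P}} in X].

End Designs.

Section Sprott.
Variable F : finFieldType.

Definition primitive_element (x : F) : Prop :=
  exists2 u : {unit F}, val u = x & generator [set: {unit F}] u.

Definition translate (B : {set F}) (v : F) : {set F} := [set b + v | b in B].

Definition dilate (c : F) (B : {set F}) : {set F} := [set c * b | b in B].

Definition base_block (x : F) (m l i : nat) : {set F} :=
  0 |: [set x ^+ (i + t * m) | t : 'I_l.-1].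

(* Sprott(#|F|, l), for x primitive and m * (l - 1) = #|F| - 1; the member
   (i, v) is the translate by v of the i-th base block. *)
Definition sprott (x : F) (m l : nat) (b : 'I_m * F) : {set F} :=
  translate (base_block x m l b.1) b.2.

Lemma primitive_elementP (x : F) :
  primitive_element x -> (#|F|.-1).-primitive_root x.
Proof.
case=> u <- /eqP gu.
have ou : #[u]%g = #|F|.-1 by rewrite /order -gu card_finField_unit.
have F1 : (0 < #|F|.-1)%N by rewrite -ou order_gt0.
rewrite /primitive_root_of_unity F1 /=; apply/forallP=> i; apply/eqP.
rewrite unity_rootE -FinRing.val_unitX.
have -> : (val (u ^+ i.+1)%g == 1) = ((u ^+ i.+1)%g == 1%g).
  by rewrite -(inj_eq val_inj).
rewrite -order_dvdn ou.
apply/idP/eqP=> [d|->//]; apply/eqP; rewrite eqn_leq ltn_ord /=.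
exact: dvdn_leq.
Qed.

Section Bibd.
Variables (x : F) (m l : nat).
Hypotheses (xP : primitive_element x) (m_gt1 : (1 < m)%N)
  (ml : (m * l.-1 = #|F|.-1)%N).

Let xpr : (m * l.-1).-primitive_root x.
Proof. by rewrite ml; apply: primitive_elementP. Qed.

Let ml_gt0 : (0 < m * l.-1)%N. Proof. exact: prim_order_gt0 xpr. Qed.
Let m_gt0 : (0 < m)%N. Proof. exact: ltnW. Qed.
Let l_gt0 : (0 < l.-1)%N. Proof. by move: ml_gt0; rewrite muln_gt0 m_gt0. Qed.

Let x_neq0 : x != 0.
Proof. by rewrite (prim_root_eq0 xpr) -lt0n. Qed.

Let xlog (y : F) : y != 0 -> exists2 e, (e < m * l.-1)%N & y = x ^+ e.
Proof.
move=> y0; have : y ^+ (m * l.-1) = 1.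
  rewrite ml; apply/(mulfI y0); rewrite -exprS prednK ?mulr1 ?expf_card //.
  exact: leq_trans _ (ltnW (card_finNzRing_gt1 F)).
by move/(prim_rootP xpr)=> [i ->]; exists i.
Qed.

Let expx_inj e e' : (e < m * l.-1)%N -> (e' < m * l.-1)%N ->
  x ^+ e = x ^+ e' -> e = e'.
Proof.
by move=> he he' /eqP; rewrite (eq_prim_root_expr xpr) !modn_small // => /eqP.
Qed.

Let lt_ml (i : 'I_m) (t : 'I_l.-1) : (i + t * m < m * l.-1)%N.
Proof.
apply: (@leq_trans (t.+1 * m)); first by rewrite mulSn ltn_add2r.
by rewrite mulnC leq_mul2l ltn_ord orbT.
Qed.

Let mem0_base i : 0 \in base_block x m l i. Proof. exact: setU11. Qed.

Let mem_base (i : 'I_m) e : (e < m * l.-1)%N ->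
  (x ^+ e \in base_block x m l i) = (e %% m == i)%N.
Proof.
move=> he; rewrite in_setU1 expf_eq0 (negPf x_neq0) andbF /=.
apply/imsetP/eqP=> [[t _ /expx_inj ->] // | ei].
  by rewrite addnC modnMDl modn_small.
have ht : (e %/ m < l.-1)%N by rewrite ltn_divLR // mulnC.
by exists (Ordinal ht) => //=; rewrite addnC -ei -divn_eq.
Qed.

Let card_base (i : 'I_m) : #|base_block x m l i| = l.
Proof.
rewrite cardsU1 card_imset.
  rewrite card_ord (_ : (0 \in _) = false) ?add1n ?prednK //.
    by case: (l) l_gt0.
  by apply/imsetP=> [[t _ /esym /eqP]]; rewrite expf_eq0 (negPf x_neq0) andbF.
move=> t t' /expx_inj e; apply: val_inj => /=.
by move/(_ (lt_ml _ _) (lt_ml _ _))/eqP: e; rewrite eqn_add2l eqn_pmul2r // => /eqP.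
Qed.

Let i0 : 'I_m := Ordinal m_gt0.

Let cls (y : F) : 'I_m := odflt i0 [pick i : 'I_m | y \in base_block x m l i].

Let clsP (y : F) (i : 'I_m) : y != 0 ->
  (y \in base_block x m l i) = (i == cls y).
Proof.
move=> y0; have [e he ye] := xlog y0.
have hi (j : 'I_m) : (y \in base_block x m l j) = (j == Ordinal (ltn_pmod e m_gt0)).
  by rewrite ye mem_base // eq_sym.
rewrite /cls; case: pickP => [j /= | /(_ (Ordinal (ltn_pmod e m_gt0)))].
  by rewrite !hi => /eqP ->.
by rewrite hi eqxx.
Qed.

(* The nonzero parts of the base blocks are the cosets of i = 0. *)
Let cls_eq (y z : F) : y != 0 -> z != 0 ->
  (cls y == cls z) = (z / y \in base_block x m l i0).
Proof.
move=> y0 z0; rewrite -(clsP _ z0).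
have [e he ye] := xlog y0; have [f hf zf] := xlog z0.
have ec : (e %% m)%N = cls y by apply/eqP; rewrite -mem_base // -ye clsP.
have [g hg zy] : exists2 g, (g < m * l.-1)%N & z / y = x ^+ g.
  by apply: xlog; rewrite mulf_neq0 ?invr_eq0.
rewrite zy zf !mem_base //= -ec.
have fg : (f = g + e %[mod m])%N.
  have : x ^+ f == x ^+ (g + e) by rewrite exprD -zy -zf -ye divfK.
  rewrite (eq_prim_root_expr xpr) => /eqP h.
  by rewrite -(modn_dvdm f (dvdn_mulr l.-1 (dvdnn m))) h modn_dvdm // dvdn_mulr.
by rewrite fg -{2}[e]add0n eqn_modDr mod0n.
Qed.

Lemma sprott_bibd : is_bibd (@sprott x m l) #|F| l l.
Proof.
have F_gt0 : (0 < #|F|)%N by exact: ltnW (card_finNzRing_gt1 F).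
have l_gt1 : (1 < l)%N by case: (l) l_gt0 => [|[]].
have memS (b : 'I_m * F) y :
    (y \in @sprott x m l b) = (y - b.2 \in base_block x m l b.1).
  apply/imsetP/idP=> [[c hc ->]|h]; first by rewrite addrK.
  by exists (y - b.2); rewrite ?subrK.
split=> //.
- rewrite -(prednK F_gt0) -ml -(ltn_predK l_gt1) ltnS /=.
  by rewrite -[X in (X < _)%N]mul1n ltn_mul2r l_gt0 m_gt1.
- move=> b; rewrite /sprott /translate card_imset ?card_base //.
  exact: addIr.
move=> A /eqP/cards2P [a [b [ab ->]]].
pose H := base_block x m l i0 :\ 0 :\ 1.
have cardH : #|H| = l.-2.
  have h1 : 1 \in base_block x m l i0.
    by rewrite -(expr0 x) mem_base ?mod0n.
  have := cardsD1 0 (base_block x m l i0).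
  rewrite mem0_base card_base add1n (cardsD1 1).
  by rewrite in_setD1 oner_eq0 h1 -/H add1n => ->.
pose f w := (w * a - b) / (w - 1).
pose V := a |: (b |: [set f w | w in H]).
pose g v := (if v == a then cls (b - a) else cls (a - v), v).
have Hn w : w \in H -> [/\ w != 1, w != 0 & w \in base_block x m l i0].
  by rewrite !in_setD1 => /and3P[].
have fa w : w != 1 -> a - f w = (b - a) / (w - 1).
  move=> w1; have n1 : w - 1 != 0 by rewrite subr_eq0.
  by rewrite /f; field.
have fb w : w != 1 -> b - f w = w * ((b - a) / (w - 1)).
  move=> w1; have n1 : w - 1 != 0 by rewrite subr_eq0.
  by rewrite /f; field.
have ba0 : b - a != 0 by rewrite subr_eq0 eq_sym.
have fV v : v != a -> v != b -> v = f ((b - v) / (a - v)).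
  move=> va vb; have av0 : a - v != 0 by rewrite subr_eq0 eq_sym.
  set w := _ / _; have w1 : w != 1.
    apply/eqP=> /(congr1 ( *%R^~ (a - v))); rewrite /w divfK // mul1r.
    by move/addIr => e; rewrite e eqxx in ab.
  apply: oppr_inj; apply: (addrI a); rewrite fa //.
  have -> : w - 1 = (b - a) / (a - v).
    by rewrite /w; field.
  by rewrite invf_div mulrCA divff // mulr1.
have -> : [set c | [set a; b] \subset @sprott x m l c] = [set g v | v in V].
  apply/setP=> [[i v]]; rewrite inE subUset !sub1set !memS /=.
  apply/andP/imsetP=> [[ha hb]|[u hu [-> ->]]].
    exists v; last first.
      congr (_, _); apply/eqP; have [va|va] := eqVneq v a.
        by rewrite -clsP // -va.
      by rewrite -clsP // subr_eq0 eq_sym.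
    rewrite !in_setU1; have [//|va /=] := eqVneq v a.
    have [//|vb /=] := eqVneq v b.
    have av0 : a - v != 0 by rewrite subr_eq0 eq_sym.
    have bv0 : b - v != 0 by rewrite subr_eq0 eq_sym.
    rewrite (fV _ va vb); apply: imset_f; rewrite !in_setD1.
    rewrite mulf_neq0 ?invr_eq0 // -cls_eq //.
    move: ha hb; rewrite !clsP // => /eqP <- ->; rewrite ?eqxx !andbT.
    apply/eqP=> /(congr1 ( *%R^~ (a - v))); rewrite divfK // mul1r.
    by move/addIr => e; rewrite e eqxx in ab.
  rewrite !in_setU1 in hu; case/or3P: hu => [/eqP->|/eqP->|/imsetP[w /Hn[w1 w0 wB] ->]].
  - by rewrite eqxx subrr mem0_base clsP.
  - by rewrite eq_sym (negPf ab) subrr mem0_base clsP // subr_eq0.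
  have n1 : w - 1 != 0 by rewrite subr_eq0.
  have y0 : (b - a) / (w - 1) != 0 by rewrite mulf_neq0 // invr_eq0.
  have -> : (f w == a) = false.
    by apply/negP=> /eqP e; move: y0; rewrite -fa // e subrr eqxx.
  have wy0 : w * ((b - a) / (w - 1)) != 0 by exact: mulf_neq0.
  rewrite fa // fb // !clsP //; split=> //.
  by rewrite cls_eq // mulfK.
rewrite card_imset; last by move=> v v' [].
have fneq w : w \in H -> (f w != a) /\ (f w != b).
  move=> /Hn[w1 w0 _]; have n1 : w - 1 != 0 by rewrite subr_eq0.
  have y0 : (b - a) / (w - 1) != 0 by rewrite mulf_neq0 // invr_eq0.
  split; rewrite eq_sym -subr_eq0; first by rewrite fa.
  by rewrite fb //; exact: mulf_neq0.
have -> : #|V| = (#|H|).+2.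
  rewrite /V !cardsU1 card_in_imset.
    have -> : (b \in [set f w | w in H]) = false.
      by apply/imsetP=> [[w /fneq [_ h] e]]; rewrite -e eqxx in h.
    have -> : (a \in b |: [set f w | w in H]) = false.
      rewrite in_setU1 (negPf ab) /=.
      by apply/imsetP=> [[w /fneq [h _] e]]; rewrite -e eqxx in h.
    by [].
  move=> w w' /Hn[w1 _ _] /Hn[w1' _ _] e.
  have := fa _ w1; rewrite e fa // => /(mulfI ba0)/invr_inj.
  by move/addIr.
by rewrite cardH; case: (l) l_gt1 => [|[]].
Qed.

End Bibd.

End Sprott.

Section SprottResolution.
Variables (F : finFieldType) (x : F) (q : nat).

Definition S00 : {set {set F}} :=
  [set base_block x q.-1 q.+2 i | i : 'I_q.-1].

Definition seed_block : {set F} :=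
  [set 0; 1] :|: [set x ^+ (t.+1 * q.-1) + 1 | t : 'I_q].

(* S0S j is the class S_{0,j+1}. *)
Definition S0S (j : nat) : {set {set F}} :=
  [set dilate (x ^+ (j + q.+1 * i)) seed_block | i : 'I_q.-1].

Definition X0 : {set {set {set F}}} := S00 |: [set S0S j | j : 'I_q.+1].

Definition X_ (v : F) : {set {set {set F}}} :=
  [set [set translate B v | B in (S : {set {set F}})]
     | S : {set {set F}} in X0].

End SprottResolution.

(* Main.v *)
Require Import Defs.
From mathcomp Require Import all_boot all_order all_algebra all_fingroup all_solvable.
From mathcomp Require Import finfield ring.

(* Write N y = y^(q+1). The block (i, v) is the circle N (y - v) = N(x)^i together
   with its centre v. Two distinct blocks through p, neither centred at p, are
   disjoint outside p exactly when p and the two centres are collinear over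
   GF(q): inversion at p turns each circle into an affine line whose direction
   depends only on the line joining p to the centre. Hence the blocks at p
   centred on a given line through p form a parallel class, as do those centred
   at p, and a counting argument excludes mixed classes, so these are all the
   parallel classes about p and the local resolution is unique.

   Blocks with distinct centres in a common class have radii adding up to the
   norm of the difference of their centres, since squaring is additive. Three
   such blocks, pairwise in common classes, then have collinear centres, and
   the tangency point of two of them is determined by one radius. *)

Set Implicit Arguments.
Unset Strict Implicit.
Unset Printing Implicit Defensive.

Import GRing.Theory.
Local Open Scope ring_scope.

(** * Finite sets and partitions *)

Lemma card_disjoint_leq (T : finType) (A B C : {set T}) :
  A \subset C -> B \subset C -> (forall s, s \in A -> s \in B -> False) ->
  (#|A| + #|B| <= #|C|)%N.
Proof.
move=> AC BC AB; rewrite -cardsUI.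
have -> : A :&: B = set0.
  by apply/setP=> s; rewrite !inE; apply/negP=> /andP[]; apply: AB.
by rewrite cards0 addn0 subset_leq_card // subUset AC.
Qed.

(** A part of [Y] outside [X] would meet a part of [X], which also lies in [Y]. *)
Lemma sub_partition_eq (T : finType) (X Y : {set {set T}}) (A : {set T}) :
  partition X A -> partition Y A -> X \subset Y -> X = Y.
Proof.
move=> pX pY XY; apply/eqP; rewrite eqEsubset XY; apply/subsetP=> S SY.
have /set0Pn[a aS] := partition_neq0 pY SY.
have aA : a \in A by rewrite -(cover_partition pY); apply/bigcupP; exists S.
have : a \in cover X by rewrite (cover_partition pX).
case/bigcupP=> R RX aR; suff -> : S = R by [].
apply/eqP; have /trivIsetP/(_ S R SY (subsetP XY _ RX)) := partition_trivIset pY.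
by move/contraR; apply; apply/pred0Pn; exists a; rewrite !inE aS.
Qed.

(** * Parallel classes in an arbitrary design *)

Section LocalResolutions.
Variables (P I : finType) (blk : I -> {set P}).
Implicit Types (p y : P) (b c : I) (S Q : {set I}).

(** Injectivity and disjointness merge into the last clause; the second clause keeps the empty set
    out of the partition. *)
Lemma parallel_classP p S :
  parallel_class blk p S <->
  [/\ S \subset blocks_at blk p,
      forall b, b \in S -> exists2 y, y != p & y \in blk b,
      forall y, y != p -> exists2 b, b \in S & y \in blk b
    & forall b c y, b \in S -> c \in S -> y != p ->
        y \in blk b -> y \in blk c -> b = c].
Proof.
split=> [[Sp inj /and3P[/eqP cov triv n0]]|[Sp ne cov disj]].
  split=> // [b bS|y yp|b c y bS cS yp yb yc].
  - have /set0Pn[y] : blk b :\ p != set0.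
      by apply: contraNneq n0 => <-; apply: imset_f.
    by rewrite in_setD1 => /andP[yp yb]; exists y.
  - have : y \in [set~ p] by rewrite !inE.
    rewrite -cov => /bigcupP[_ /imsetP[b bS ->]].
    by rewrite in_setD1 => /andP[_ yb]; exists b.
  - apply: inj => //; apply/eqP.
    have := trivIsetP triv _ _ (imset_f _ bS) (imset_f _ cS).
    move/contraR; apply; apply/pred0Pn; exists y.
    by rewrite !inE yp yb yc.
split=> // [b c bS cS ebc|].
  have [y yp yb] := ne b bS; apply: (disj _ _ y) => //.
  have : y \in blk b :\ p by rewrite in_setD1 yp.
  by rewrite ebc in_setD1 => /andP[].
apply/and3P; split.
- apply/eqP/setP=> y; rewrite !inE; apply/bigcupP/idP.
    by case=> _ /imsetP[b _ ->]; rewrite in_setD1 => /andP[].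
  move=> yp; have [b bS yb] := cov y yp.
  by exists (blk b :\ p); [apply/imsetP; exists b | rewrite in_setD1 yp].
- apply/trivIsetP=> _ _ /imsetP[b bS ->] /imsetP[c cS ->].
  apply: contraR => /pred0Pn[y]; rewrite !inE.
  case/andP=> /andP[yp yb] /andP[_ yc].
  by rewrite (disj b c y).
apply/imsetP=> -[b bS /setP e]; have [y yp yb] := ne b bS.
by have := e y; rewrite in_set0 in_setD1 yp yb.
Qed.

(** A further block of [Q] would share a point other than [p] with a block of [S]. An inclusion thus
    suffices to identify a class. *)
Lemma parallel_class_max p S Q :
  parallel_class blk p S -> parallel_class blk p Q -> S \subset Q -> S = Q.
Proof.
move=> /parallel_classP[_ _ covS _] /parallel_classP[_ neQ _ disjQ] SQ.
apply/eqP; rewrite eqEsubset SQ /=; apply/subsetP=> c cQ.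
have [y yp yc] := neQ c cQ; have [b bS yb] := covS y yp.
by rewrite -(disjQ b c y) // (subsetP SQ).
Qed.

Lemma parallel_class_card p S k :
  parallel_class blk p S -> (forall b, #|blk b| = k.+1) ->
  (#|S| * k = #|P|.-1)%N.
Proof.
case=> Sp inj part cardk; rewrite -(cardsC1 p) -(card_in_imset inj).
apply/esym; apply: card_uniform_partition part => _ /imsetP[b bS ->].
have := subsetP Sp b bS; rewrite inE => pb.
by have := cardsD1 p (blk b); rewrite pb cardk => -[].
Qed.

End LocalResolutions.

(** * Norm and collinearity over the subfield of order [q] *)

Section NormCircles.
Variables (n q : nat) (F : finFieldType) (x : F).
Hypotheses (hq : q = (2 ^ n)%N) (hq2 : (2 < q)%N) (hF : #|F| = (q ^ 2)%N).
Hypothesis hx : primitive_element x.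
Implicit Types (a b d u v w y z p : F).

Local Notation N y := (y ^+ q.+1).
Local Notation blk := (@sprott F x q.-1 q.+2).
Local Notation index := ('I_q.-1 * F)%type.
Local Notation cls := (fun v : F => members blk (X_ x q v)).

Let q_gt0 : (0 < q)%N. Proof. exact: leq_trans hq2. Qed.

Let pcharF2 : 2%N \in [pchar F].
Proof. by apply: (@card_finPcharP _ _ (n * 2)); rewrite // hF hq expnM. Qed.

Let two0 : 1 + 1 = 0 :> F. Proof. exact: addrr_pchar2. Qed.

Lemma addr_eq0_pchar2 a b : (a + b == 0) = (a == b).
Proof. by rewrite addr_eq0 oppr_pchar2. Qed.

Lemma frobD a b : (a + b) ^+ q = a ^+ q + b ^+ q.
Proof. by apply: exprDn_pchar; rewrite hq pnatX pnatE ?pcharF2. Qed.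

Lemma frobK a : (a ^+ q) ^+ q = a.
Proof. by rewrite -exprM -[RHS]expf_card hF. Qed.

Lemma frob_norm a : N a ^+ q = N a.
Proof. by rewrite exprS exprMn frobK mulrC. Qed.

Lemma norm_eq0 a : (N a == 0) = (a == 0).
Proof. by rewrite expf_eq0. Qed.

(** The cross term is a trace; in characteristic 2 it vanishes exactly when [a] and [b] are
    collinear. *)
Lemma normD a b : N (a + b) = N a + N b + (a ^+ q * b + a * b ^+ q).
Proof. by rewrite !exprS frobD; ring. Qed.

Lemma sqr_inj a b : a ^+ 2 = b ^+ 2 -> a = b.
Proof.
move=> e; apply/eqP; rewrite -addr_eq0_pchar2 -sqrf_eq0.
have -> : (a + b) ^+ 2 = a ^+ 2 + b ^+ 2 by ring: two0.
by rewrite e addrr_pchar2.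
Qed.

(* [a] and [b] are proportional over the subfield of order [q]. *)
Definition collinear a b := a ^+ q * b == a * b ^+ q.

Lemma collinearxx a : collinear a a.
Proof. by rewrite /collinear mulrC. Qed.

Lemma collinear_sym a b : collinear a b = collinear b a.
Proof. by rewrite /collinear eq_sym mulrC [X in _ == X]mulrC. Qed.

Lemma collinear_trans b a d : b != 0 ->
  collinear a b -> collinear b d -> collinear a d.
Proof.
move=> b0 /eqP e1 /eqP e2; apply/eqP/(mulfI b0).
have -> : b * (a ^+ q * d) = a ^+ q * b * d by ring.
have -> : b * (a * d ^+ q) = a * (b * d ^+ q) by ring.
by rewrite e1 -e2; ring.
Qed.

Lemma collinear_normD a b : collinear a b -> N (a + b) = N a + N b.
Proof. by move=> /eqP e; rewrite normD e addrr_pchar2 ?addr0. Qed.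

Lemma collinear_norm_inj a b : collinear a b -> N a = N b -> a = b.
Proof.
move=> ab e; apply/eqP; rewrite -addr_eq0_pchar2 -norm_eq0.
by rewrite collinear_normD // e addrr_pchar2.
Qed.

(** * Circles through 0 *)

(* The two circles through [0] meet again at the point which the inversion
   [z |-> z ^- q] sends to the intersection of two lines. *)
Lemma circles_meet a b : ~~ collinear a b ->
  exists z, [/\ z != 0, N (z + a) = N a & N (z + b) = N b].
Proof.
rewrite /collinear -addr_eq0_pchar2; set t := _ + _ => t0.
have tq : t ^+ q = t by rewrite /t frobD !exprMn !frobK addrC.
have ab0 : a + b != 0.
  apply: contraNneq t0 => /eqP; rewrite addr_eq0_pchar2 => /eqP e.
  by rewrite /t e mulrC addrr_pchar2.
have abq0 : (a + b) ^+ q != 0 by rewrite expf_neq0.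
have zq : (t / (a + b) ^+ q) ^+ q = t / (a + b).
  by rewrite expr_div_n frobK tq.
(* [A] and [B] name the conjugates, so that [field] treats them as atoms. *)
have [A fa] : {A | A = a ^+ q} by exists (a ^+ q).
have [B fb] : {B | B = b ^+ q} by exists (b ^+ q).
have AB0 : A + B != 0 by rewrite fa fb -frobD.
(* With [w = z ^- q], dividing [N (z + a) = N a] by [N z] gives the line
   [a ^+ q * w + a * w ^+ q = 1]. Cramer's rule with the line of [b] yields [w = (a + b) / t]. *)
exists (t / (a + b) ^+ q); split.
- by rewrite mulf_neq0 ?invr_eq0.
- rewrite normD -[RHS](add0r (N a)) addrAC; congr (_ + _).
  rewrite !exprS zq frobD -fa -fb.
  (* [field] ignores the characteristic, so the factor 2 is exhibited. *)
  transitivity ((1 + 1) * (t * (t + a * A) / ((a + b) * (A + B)))).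
    by rewrite /t -fa -fb; field; rewrite ?AB0 ?ab0.
  by rewrite two0 mul0r.
- rewrite normD -[RHS](add0r (N b)) addrAC; congr (_ + _).
  rewrite !exprS zq frobD -fa -fb.
  transitivity ((1 + 1) * (t * (t + b * B) / ((a + b) * (A + B)))).
    by rewrite /t -fa -fb; field; rewrite ?AB0 ?ab0.
  by rewrite two0 mul0r.
Qed.

(* [z] lies on the block with centre [a] through [0]. *)
Definition on_block a z := (z == a) || (N (z + a) == N a).

(** Neither centre lies on the other circle, since norms of collinear elements add. A common point
    satisfies [N z = z ^+ q * a + z * a ^+ q] and the same for [b]; cross-multiplying gives
    [N z * a = N z * b]. *)
Lemma on_block_disjoint a b z : a != 0 -> b != 0 -> z != 0 ->
  collinear a b -> on_block a z -> on_block b z -> a = b.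
Proof.
move=> a0 b0 z0 ab /orP[/eqP za|ha] /orP[/eqP zb|hb].
- by rewrite -za.
- by move: hb; rewrite za collinear_normD // -subr_eq0 addrK norm_eq0 (negPf a0).
- move: ha; rewrite zb [b + a]addrC collinear_normD //.
  by rewrite [N a + _]addrC -subr_eq0 addrK norm_eq0 (negPf b0).
have tang (c : F) : N (z + c) == N c -> z * z ^+ q = z ^+ q * c + z * c ^+ q.
  rewrite normD addrAC -subr_eq0 addrK addr_eq0_pchar2.
  by rewrite exprS => /eqP.
have /eqP e := ab; have zq0 : z * z ^+ q != 0 by rewrite mulf_neq0 ?expf_neq0.
apply/(mulfI zq0)/esym; rewrite {1}(tang a ha) (tang b hb).
have -> : (z ^+ q * b + z * b ^+ q) * a = z ^+ q * a * b + z * (a * b ^+ q) by ring.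
by rewrite -e; ring.
Qed.

(** If [z] is on the line of [d], it is itself the centre. Otherwise the centre is [s * d] with [s]
    in the subfield: the circle equation becomes [N z = s * t], where [t] is nonzero. *)
Lemma on_block_cover d z : d != 0 -> z != 0 ->
  exists a, [/\ a != 0, collinear a d & on_block a z].
Proof.
move=> d0 z0; have [zd|] := boolP (collinear z d).
  by exists z; rewrite /on_block eqxx.
rewrite /collinear -addr_eq0_pchar2; set t := _ + _ => t0.
have tq : t ^+ q = t by rewrite /t frobD !exprMn !frobK addrC.
have s0 : N z / t != 0 by rewrite mulf_neq0 ?invr_eq0 ?norm_eq0.
have : (N z / t) ^+ q = N z / t by rewrite expr_div_n frob_norm tq.
have : N z = N z / t * t by rewrite mulfVK.
move: s0; set s := N z / t => s0 Nz sq.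
exists (s * d); rewrite mulf_neq0 //; split=> //.
  by rewrite /collinear exprMn sq; apply/eqP; ring.
apply/orP; right; rewrite normD -[X in _ == X]add0r addrAC.
rewrite (inj_eq (addIr _)) addr_eq0_pchar2 Nz exprMn sq /t; apply/eqP; ring.
Qed.

(* The tangency point [p] of two circles is determined by their centres and
   one of the radii. *)
Lemma tangent_point p v w : collinear (v + p) (w + p) ->
  (p + v) ^+ 2 * (v + w) ^+ q = N (v + p) * (v + w).
Proof.
have -> : v + w = (v + p) + (w + p) by ring: two0.
rewrite [p + v]addrC; set a := v + p; set b := w + p => /eqP ab.
rewrite frobD [N a]exprS; transitivity (a * (a * a ^+ q + a * b ^+ q)); first ring.
rewrite -ab; ring.
Qed.


(** * Blocks of the design as circles with their centres *)

Lemma mem_translate (B : {set F}) v y : (y \in translate B v) = (y - v \in B).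
Proof.
apply/imsetP/idP=> [[c cB ->]|yB]; first by rewrite addrK.
by exists (y - v); rewrite ?subrK.
Qed.

Let card_pred : (#|F|.-1 = q.-1 * q.+1)%N.
Proof.
by rewrite hF; case: q q_gt0 => // k _; rewrite expnS expn1 mulSn [in RHS]mulnS.
Qed.

Let xpr : (q.-1 * q.+1).-primitive_root x.
Proof. by rewrite -card_pred; apply: primitive_elementP. Qed.

Let q1_gt0 : (0 < q.-1)%N. Proof. by case: q hq2 => [|[]]. Qed.

Let x_neq0 : x != 0.
Proof. by rewrite (prim_root_eq0 xpr) -lt0n muln_gt0 q1_gt0. Qed.

Lemma unit_circleP u : N u = 1 -> exists t : 'I_q.+1, u = x ^+ (t * q.-1).
Proof.
have := dvdn_prim_root xpr (dvdn_mull q.-1 (dvdnn q.+1)).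
rewrite mulnK // => pr /(prim_rootP pr)[t ->].
by exists t; rewrite -exprM mulnC.
Qed.

Let normx_pr : q.-1.-primitive_root (N x).
Proof.
have := dvdn_prim_root xpr (dvdn_mulr q.+1 (dvdnn q.-1)).
by rewrite mulKn.
Qed.

Lemma subfieldP s : s != 0 -> s ^+ q = s -> exists i : 'I_q.-1, s = N x ^+ i.
Proof.
move=> s0 sq; have : s ^+ q.-1 = 1.
  by apply: (mulfI s0); rewrite -exprS prednK // mulr1.
by move/(prim_rootP normx_pr)=> [i]; exists i.
Qed.

Lemma norm_log y : y != 0 -> exists i : 'I_q.-1, N y = N x ^+ i.
Proof. by move=> y0; apply: subfieldP; rewrite ?norm_eq0 ?frob_norm. Qed.

Lemma norm_exp_inj (i j : 'I_q.-1) : N x ^+ i = N x ^+ j -> i = j.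
Proof.
move/eqP; rewrite (eq_prim_root_expr normx_pr) !modn_small // => /eqP e.
exact: val_inj.
Qed.

(** [x ^+ q.-1] generates the elements of norm 1, so its cosets are the fibres of the norm. *)
Lemma mem_base_block (i : nat) y :
  (y \in base_block x q.-1 q.+2 i) = (y == 0) || (N y == N x ^+ i).
Proof.
rewrite in_setU1; congr (_ || _); apply/imsetP/eqP=> [[t _ ->]|e].
  rewrite exprD exprMn exprAC -[X in _ * X]exprM -mulnA [(t * _)%N]mulnC exprM.
  by rewrite (prim_expr_order xpr) expr1n mulr1.
have xi0 : x ^+ i != 0 by rewrite expf_neq0.
have : N (y / x ^+ i) = 1.
  by rewrite expr_div_n e -!exprM mulnC divff // expf_neq0.
case/unit_circleP=> t yE; exists t => //.
by rewrite exprD -yE mulrCA divff ?mulr1.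
Qed.

Lemma mem_blk (b : index) y : (y \in blk b) = (y == b.2) || (N (y + b.2) == N x ^+ b.1).
Proof.
by rewrite mem_translate mem_base_block subr_eq0 oppr_pchar2.
Qed.

Lemma blk_norm p (b : index) : p \in blk b -> b.2 != p -> N (b.2 + p) = N x ^+ b.1.
Proof. by rewrite mem_blk eq_sym addrC => /orP[->|/eqP]. Qed.

Lemma mem_blk_at p (b : index) y : p \in blk b -> b.2 != p ->
  (y \in blk b) = on_block (b.2 + p) (y + p).
Proof.
move=> pb bp; rewrite mem_blk -(blk_norm pb bp) /on_block.
rewrite (inj_eq (addIr p)); congr (_ || (N _ == _)).
by ring: two0.
Qed.

Lemma mem_blk_center (b : index) y : (b.2 + y \in blk b) = (y == 0) || (N y == N x ^+ b.1).
Proof.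
rewrite mem_blk -subr_eq0 addrAC subrr add0r addrAC addrr_pchar2 //.
by rewrite add0r.
Qed.

Lemma center_in_blk (b : index) : b.2 \in blk b.
Proof. by rewrite mem_blk eqxx. Qed.

Lemma card_blk (b : index) : #|blk b| = q.+2.
Proof.
have q1_gt1 : (1 < q.-1)%N by case: q hq2 => [|[|[]]].
by case: (sprott_bibd (l := q.+2) hx q1_gt1 (esym card_pred)).
Qed.

(** * Norms on a circle through 0, and exclusion of mixed classes *)

Definition traces : {set F} := [set u + u^-1 | u in [set u : F | (N u == 1) && (u != 1)]].

(** The nonzero points of the circle [N (z + 1) = 1] are [z = 1 + u] with [N u = 1] and [u != 1],
    and [N z = u + u ^+ q]. *)
Lemma tracesP t : t \in traces ->
  exists z, [/\ z != 0, on_block 1 z & N z = t].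
Proof.
case/imsetP=> u; rewrite inE => /andP[/eqP Nu u1] ->.
have u0 : u != 0 by rewrite -norm_eq0 Nu oner_neq0.
have uq : u ^+ q = u^-1 by apply: (mulfI u0); rewrite -exprS Nu divff.
exists (1 + u); split; first by rewrite addr_eq0_pchar2 eq_sym.
  apply/orP; right; rewrite addrAC two0 add0r Nu expr1n //.
by rewrite normD !expr1n !mul1r Nu two0 add0r uq.
Qed.

(* [u |-> u + u^-1] is two-to-one on the [q] nontrivial elements of norm 1. *)
Lemma card_traces : (q <= #|traces| * 2)%N.
Proof.
set U := [set u : F | (N u == 1) && (u != 1)].
have cardU : (q <= #|U|)%N.
  have pr := dvdn_prim_root xpr (dvdn_mull q.-1 (dvdnn q.+1)).
  rewrite mulnK // in pr.
  rewrite -[X in (X <= _)%N](card_ord q).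
  (* Starting the exponents at 1 avoids [u = 1]. *)
  pose f (t : 'I_q) := x ^+ q.-1 ^+ t.+1.
  rewrite -(card_imset (f := f)); last first.
    move=> t t' /eqP; rewrite (eq_prim_root_expr pr) !modn_small ?ltnS ?ltn_ord // => /eqP[].
    exact: val_inj.
  apply: subset_leq_card; apply/subsetP=> _ /imsetP[t _ ->]; rewrite inE /f.
  rewrite exprAC (prim_expr_order pr) expr1n eqxx /=.
  by rewrite -(expr0 (x ^+ q.-1)) (eq_prim_root_expr pr) !modn_small ?ltnS ?ltn_ord.
apply: leq_trans cardU _; rewrite -sum1_card /=.
rewrite (partition_big_imset (fun u : F => u + u^-1)) /= -/traces -sum_nat_const.
apply: leq_sum => t /imsetP[u uU ->]; rewrite sum1dep_card.
apply: (@leq_trans #|[set u; u^-1]|); last by rewrite cards2; case: eqP.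
apply: subset_leq_card; apply/subsetP=> w; rewrite !inE => /andP[/andP[/eqP Nw _] /eqP e].
move: uU; rewrite inE => /andP[/eqP Nu _].
have u0 : u != 0 by rewrite -norm_eq0 Nu oner_neq0.
have w0 : w != 0 by rewrite -norm_eq0 Nw oner_neq0.
have : (w - u) * (w - u^-1) = 0.
  transitivity (w * ((w + w^-1) - (u + u^-1))); last by rewrite e subrr mulr0.
  by field; rewrite ?w0 ?u0.
by move/eqP; rewrite mulf_eq0 !subr_eq0.
Qed.

Lemma trace_on_block a t : a != 0 -> t \in traces ->
  exists z, [/\ z != 0, on_block a z & N z = N a * t].
Proof.
move=> a0 /tracesP[z [z0 oz <-]]; exists (a * z); split.
- exact: mulf_neq0.
- case/orP: oz => [/eqP->|/eqP e]; first by rewrite /on_block mulr1 eqxx.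
  apply/orP; right; rewrite -[X in _ + X]mulr1 -mulrDr exprMn e.
  by rewrite expr1n mulr1.
- by rewrite exprMn.
Qed.

(** If the centres differed, the nonzero points of a circle through 0 would all have one norm,
    making [traces] a subset of a singleton; this contradicts [q > 2]. *)
Lemma blk_inj : injective blk.
Proof.
move=> b c e; have [e2|ne] := eqVneq b.2 c.2.
  have : b.2 + x ^+ b.1 \in blk c.
    by rewrite -e mem_blk_center exprAC eqxx orbT.
  rewrite e2 mem_blk_center expf_eq0 (negPf x_neq0) andbF exprAC /= => /eqP.
  move/norm_exp_inj; case: b c e2 {e} => [i v] [j w] /= -> ->.
  by [].
have pc : b.2 \in blk c by rewrite -e center_in_blk.
have cp : c.2 != b.2 by rewrite eq_sym.
have a0 : c.2 + b.2 != 0 by rewrite addr_eq0_pchar2.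
suff /subset_leq_card : traces \subset [set N x ^+ b.1 / N (c.2 + b.2)].
  rewrite cards1 => le1; have := leq_trans card_traces (leq_mul le1 (leqnn 2)).
  by rewrite leqNgt hq2.
apply/subsetP=> t /(trace_on_block a0)[z [z0 oz Nz]]; rewrite inE.
have : b.2 + z \in blk c.
  by rewrite (mem_blk_at _ pc cp) [b.2 + z]addrC -addrA addrr_pchar2 // addr0.
rewrite -e mem_blk_center (negPf z0) Nz /= => /eqP <-.
by rewrite mulrC mulKf // norm_eq0.
Qed.

Lemma disjoint_collinear p (b c : index) :
  p \in blk b -> p \in blk c -> b.2 != p -> c.2 != p ->
  (forall y, y != p -> y \in blk b -> y \in blk c -> b = c) ->
  collinear (b.2 + p) (c.2 + p).
Proof.
move=> pb pc bp cp dis; apply/idPn=> ncol; have [z [z0 zb zc]] := circles_meet ncol.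
have zpK : z + p + p = z by rewrite -addrA addrr_pchar2 // addr0.
(* A common point forces [b = c], where collinearity is trivial. *)
case/negP: (ncol); rewrite (dis (z + p)) ?collinearxx //.
- by rewrite -subr_eq0 addrK.
- by rewrite (mem_blk_at _ pb bp) zpK /on_block zb eqxx orbT.
- by rewrite (mem_blk_at _ pc cp) zpK /on_block zc eqxx orbT.
Qed.

(* If both kinds of block occur in a parallel class, each kind must avoid the
   norms met by a block of the other kind. These are at least [q / 2], so
   neither kind has more than [q / 2 - 1] blocks, but there are [q - 1]. *)
Lemma parallel_class_not_mixed p S (b c : index) :
  parallel_class blk p S -> b \in S -> c \in S -> b.2 = p -> c.2 != p -> False.
Proof.
move=> parS bS cS bp cp; case/parallel_classP: (parS) => Sp _ _ dis.
have Sat (d : index) : d \in S -> p \in blk d by move/(subsetP Sp); rewrite inE.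
have cardS : (#|S| = q.-1)%N.
  have := parallel_class_card parS card_blk; rewrite card_pred.
  by move/eqP; rewrite eqn_pmul2r // => /eqP.
pose A : {set F} := [set N x ^+ i | i : 'I_q.-1].
have cardA : (#|A| <= q.-1)%N by rewrite -[X in (_ <= X)%N]card_ord leq_imset_card.
have normA y : y != 0 -> N y \in A.
  by case/norm_log=> i ->; apply: imset_f.
pose r (d : index) := N x ^+ d.1.
have rA (d : index) : r d \in A by apply: imset_f.
pose Sc := [set d : index in S | d.2 == p]; pose Sd := [set d : index in S | d.2 != p].
(* A circle about [p] meets [d] if its radius is a trace times the radius of [d]. *)
have clash (d e : index) t : d \in Sd -> e \in Sc -> t \in traces -> r e = N (d.2 + p) * t -> False.
  rewrite !inE => /andP[dS dp] /andP[eS /eqP ep] tT re.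
  have a0 : d.2 + p != 0 by rewrite addr_eq0_pchar2.
  have [z [z0 oz Nz]] := trace_on_block a0 tT.
  have zpK : z + p + p = z by rewrite -addrA addrr_pchar2 // addr0.
  suff de : d = e by move: dp; rewrite de ep eqxx.
  apply: (dis _ _ (z + p)) => //.
  - by rewrite -subr_eq0 addrK.
  - by rewrite (mem_blk_at _ (Sat _ dS) dp) zpK.
  - by rewrite addrC -ep mem_blk_center Nz -re eqxx orbT.
have cardScd : (#|Sc| + #|Sd| = q.-1)%N.
  apply: etrans cardS; rewrite -(cardsID [set d : index | d.2 == p] S); congr (_ + _)%N; apply: eq_card => d.
    by rewrite !inE.
  by rewrite !inE andbC.
have cSd : c \in Sd by rewrite inE cS.
have bSc : b \in Sc by rewrite inE bS bp eqxx.
(* By [clash] with [c], radii in [Sc] avoid the values [N (c.2 + p) * t]. *)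
have boundc : (#|Sc| + #|traces| <= q.-1)%N.
  apply: leq_trans cardA; have a0 : c.2 + p != 0 by rewrite addr_eq0_pchar2.
  rewrite -(card_in_imset (f := r) (D := Sc)); last first.
    move=> d e; rewrite !inE => /andP[_ /eqP d2] /andP[_ /eqP e2] /norm_exp_inj d1.
    by apply: injective_projections; rewrite // d2 e2.
  have Na0 : N (c.2 + p) != 0 by rewrite norm_eq0.
  rewrite -(card_imset (mem traces) (mulfI Na0)).
  apply: card_disjoint_leq.
  - by apply/subsetP=> _ /imsetP[d _ ->].
  - apply/subsetP=> _ /imsetP[t tT ->].
    by have [z [z0 _ <-]] := trace_on_block a0 tT; apply: normA.
  - by move=> _ /imsetP[d dSc ->] /imsetP[t tT]; apply: clash tT.
(* By [clash] with [b], radii in [Sd] avoid the values [r b / t]. They are distinct because the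
   centres are collinear with [p]. *)
have boundd : (#|Sd| + #|traces| <= q.-1)%N.
  apply: leq_trans cardA.
  have rSd (d : index) : d \in Sd -> r d = N (d.2 + p).
    by rewrite inE => /andP[dS dp]; rewrite blk_norm ?Sat.
  rewrite -(card_in_imset (f := r) (D := Sd)); last first.
    move=> d e dSd eSd re; have := re; rewrite !rSd //.
    move: dSd eSd; rewrite !inE => /andP[dS dp] /andP[eS ep].
    move/(collinear_norm_inj _) => h.
    have /h/addIr d2 : collinear (d.2 + p) (e.2 + p).
      by apply: disjoint_collinear; rewrite ?Sat // => y; apply: dis.
    by apply: injective_projections => //; apply: norm_exp_inj.
  have rb0 : r b != 0 by rewrite !expf_neq0.
  have inj : injective (fun t => r b / t) by move=> s t /(mulfI rb0)/invr_inj.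
  rewrite -(card_imset (mem traces) inj).
  apply: card_disjoint_leq.
  - by apply/subsetP=> _ /imsetP[d _ ->].
  - apply/subsetP=> _ /imsetP[t /tracesP[z [z0 _ <-]] ->].
    by rewrite /r exprAC -expr_div_n normA // mulf_neq0 ?invr_eq0 ?expf_neq0.
  - move=> _ /imsetP[d dSd ->] /imsetP[t tT]; rewrite rSd // => e.
    apply: (clash d b t) => //; rewrite e divfK //.
    by have [z [z0 _ <-]] := tracesP tT; rewrite norm_eq0.
(* The sum of the bounds leaves [#|traces| * 2 <= q.-1]. *)
have := leq_add boundc boundd; rewrite addnACA cardScd leq_add2l addnn -muln2.
move/(leq_trans card_traces); apply/negP.
by rewrite -ltnNge prednK.
Qed.

(** * The prescribed classes in terms of centres *)

Lemma mem_seed w : (w \in seed_block x q) = (w == 1) || (N (w + 1) == 1).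
Proof.
rewrite !inE; have [->|w1] := eqVneq w 1; first by rewrite orbT.
rewrite orbF; apply/orP/eqP=> [[/eqP->|/imsetP[t _ ->]]|/unit_circleP[[[|t] ltt] wE]].
- by rewrite add0r expr1n.
- rewrite -addrA two0 addr0 -exprM -mulnA mulnC exprM.
  by rewrite (prim_expr_order xpr) expr1n.
(* Exponent 0 yields the element 0, which the seed block lists separately. *)
- by left; apply/eqP/(addIr 1); rewrite wE add0r.
right; apply/imsetP; exists (Ordinal (ltt : t < q)%N) => //=.
by rewrite -wE -addrA two0 addr0.
Qed.

Lemma translate_seed d p (i : 'I_q.-1) : d != 0 -> N d = N x ^+ i ->
  translate (dilate d (seed_block x q)) p = blk (i, p + d).
Proof.
move=> d0 Nd; apply/setP=> y; rewrite mem_blk mem_translate /= -Nd.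
have -> : (y - p \in dilate d (seed_block x q)) = ((y - p) / d \in seed_block x q).
  apply/imsetP/idP=> [[w wB ->]|wB]; first by rewrite mulrC mulKf.
  by exists ((y - p) / d); rewrite // mulrC divfK.
rewrite mem_seed; congr (_ || _).
  by rewrite -(inj_eq (mulIf d0)) mul1r divfK // subr_eq addrC.
have -> : (y - p) / d + 1 = (y + (p + d)) / d.
  by rewrite oppr_pchar2 // addrA [(y + p + d) / d]mulrDl divff.
have Nd0 : N d != 0 by rewrite norm_eq0.
by rewrite expr_div_n -(inj_eq (mulIf Nd0)) mul1r divfK.
Qed.

Definition concentric p : {set index} := [set b : index | b.2 == p].

Definition tangent p d : {set index} :=
  [set b in blocks_at blk p | (b.2 != p) && collinear (b.2 + p) d].

Lemma mem_tangent p d (b : index) :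
  (b \in tangent p d) = [&& p \in blk b, b.2 != p & collinear (b.2 + p) d].
Proof. by rewrite !inE. Qed.

Lemma collinearZ s a : s ^+ q = s -> collinear (s * a) a.
Proof. by move=> e; rewrite /collinear exprMn e; apply/eqP; ring. Qed.

Lemma collinear_subfield a d : d != 0 -> collinear a d -> (a / d) ^+ q = a / d.
Proof.
move=> d0 /eqP e; have dq0 : d ^+ q != 0 by rewrite expf_neq0.
by rewrite expr_div_n; apply/eqP; rewrite eqr_div // e.
Qed.

Lemma preimset_S00 p :
  blk @^-1: [set translate B p | B in S00 x q] = concentric p.
Proof.
apply/setP=> b; rewrite !inE; apply/imsetP/eqP=> [[_ /imsetP[i _ ->]]|<-].
  by move/(@blk_inj b (i, p)) ->.
by exists (base_block x q.-1 q.+2 b.1) => //; apply: imset_f.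
Qed.

(** The factors [x ^+ (q.+1 * i)] run through the nonzero subfield elements, so the dilations move
    the centre along the line of direction [x ^+ j]. *)
Lemma preimset_S0S p (j : nat) :
  blk @^-1: [set translate B p | B in S0S x q j] = tangent p (x ^+ j).
Proof.
have xj0 : x ^+ j != 0 by rewrite expf_neq0.
have zpK z : p + z + p = z by rewrite addrAC addrr_pchar2 // add0r.
apply/setP=> b; rewrite mem_tangent inE; apply/imsetP/and3P.
  case=> _ /imsetP[i _ ->]; set d := x ^+ _.
  have d0 : d != 0 by rewrite expf_neq0.
  have [k Nd] := norm_log d0.
  rewrite (translate_seed _ d0 Nd) => /(@blk_inj b (k, _)) -> /=; split.
  - by rewrite mem_blk /= addrA addrr_pchar2 // add0r -Nd eqxx orbT.
  - by rewrite -subr_eq0 [p + d]addrC addrK.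
  rewrite zpK /d exprD mulrC exprM; apply: collinearZ.
  by rewrite -exprM mulnC exprM frob_norm.
case=> pb bp col; set a := b.2 + p.
have a0 : a != 0 by rewrite addr_eq0_pchar2.
have [] := @subfieldP (a / x ^+ j) _ (collinear_subfield xj0 col).
  by rewrite mulf_neq0 ?invr_eq0.
move=> i aE; exists (dilate (x ^+ (j + q.+1 * i)) (seed_block x q)).
  exact: imset_f.
have -> : x ^+ (j + q.+1 * i) = a by rewrite exprD exprM -aE mulrCA divff ?mulr1.
rewrite (translate_seed _ a0 (blk_norm pb bp)) /a addrCA addrr_pchar2 // addr0.
by case: (b).
Qed.

Lemma tangent_collinear p d (e : F) : d != 0 -> e != 0 -> collinear d e ->
  tangent p d = tangent p e.
Proof.
move=> d0 e0 de; apply/setP=> b; rewrite !mem_tangent; congr [&& _, _ & _].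
apply/idP/idP=> h; first exact: collinear_trans h de.
by apply: collinear_trans h _; rewrite // collinear_sym.
Qed.

(** Since [x ^+ q.+1] lies in the subfield, only the exponent modulo [q.+1] affects the
    direction. *)
Lemma tangent_log p d : d != 0 -> exists j : 'I_q.+1, tangent p d = tangent p (x ^+ j).
Proof.
move=> d0; have : d ^+ (q.-1 * q.+1) = 1.
  rewrite -card_pred.
  have F_gt0 : (0 < #|F|)%N by rewrite hF expn_gt0 q_gt0.
  by apply: (mulfI d0); rewrite -exprS prednK // expf_card mulr1.
case/(prim_rootP xpr)=> e dE.
exists (Ordinal (ltn_pmod e (ltn0Sn q))) => /=.
apply: tangent_collinear; rewrite ?expf_neq0 // dE.
rewrite {1}(divn_eq e q.+1) exprD; apply: collinearZ.
by rewrite mulnC exprM -exprM mulnC exprM frob_norm.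
Qed.

Lemma mem_classes p (S : {set index}) :
  S \in cls p <-> S = concentric p \/ exists2 d, d != 0 & S = tangent p d.
Proof.
split=> [/imsetP[_ /imsetP[R RX ->] ->]|].
  case/setU1P: RX => [->|/imsetP[j _ ->]]; first by left; rewrite preimset_S00.
  by right; exists (x ^+ j); [rewrite expf_neq0|rewrite preimset_S0S].
case=> [->|[d d0 ->]].
  rewrite -preimset_S00; apply: imset_f; apply: imset_f; exact: setU11.
have [j ->] := tangent_log p d0; rewrite -preimset_S0S.
by apply: imset_f; apply: imset_f; apply/setU1P; right; apply: imset_f.
Qed.

(** * Classification of parallel classes and uniqueness *)

Lemma parallel_concentric p : parallel_class blk p (concentric p).
Proof.
apply/parallel_classP; split.
- by apply/subsetP=> b; rewrite !inE => /eqP <-; apply: center_in_blk.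
- move=> b; rewrite inE => /eqP <-; exists (b.2 + x ^+ b.1).
    by rewrite -subr_eq0 addrAC subrr add0r expf_neq0.
  by rewrite mem_blk_center exprAC eqxx orbT.
- move=> y yp; have yp0 : y + p != 0 by rewrite addr_eq0_pchar2.
  have [i Ny] := norm_log yp0; exists (i, p); first by rewrite inE.
  by rewrite mem_blk /= Ny eqxx orbT.
move=> b c y; rewrite !inE => /eqP bp /eqP cp yp.
rewrite !mem_blk bp cp (negPf yp) /= => /eqP -> /eqP/norm_exp_inj bc.
by apply: injective_projections; rewrite // bp cp.
Qed.

Lemma parallel_tangent p d : d != 0 -> parallel_class blk p (tangent p d).
Proof.
move=> d0; apply/parallel_classP; split.
- by apply/subsetP=> b; rewrite mem_tangent inE => /and3P[].
- move=> b; rewrite mem_tangent => /and3P[_ bp _].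
  by exists b.2 => //; apply: center_in_blk.
- move=> y yp; have yp0 : y + p != 0 by rewrite addr_eq0_pchar2.
  have [a [a0 ad oa]] := on_block_cover d0 yp0.
  have [i Na] := norm_log a0.
  have apK : a + p + p = a by rewrite -addrA addrr_pchar2 // addr0.
  have pb : p \in blk (i, a + p).
    by rewrite mem_blk /= addrCA addrr_pchar2 // addr0 Na eqxx orbT.
  have bp : (i, a + p).2 != p by rewrite -subr_eq0 addrK.
  exists (i, a + p); first by rewrite mem_tangent pb bp /= apK.
  by rewrite (mem_blk_at _ pb bp) /= apK.
move=> b c y; rewrite !mem_tangent => /and3P[pb bp bd] /and3P[pc cp cd] yp.
rewrite (mem_blk_at _ pb bp) (mem_blk_at _ pc cp) => yb yc.
have bc2 : b.2 = c.2.
  apply: (addIr p); apply: on_block_disjoint yb yc; rewrite ?addr_eq0_pchar2 //.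
  by apply: collinear_trans d0 bd _; rewrite collinear_sym.
apply: injective_projections => //; apply: norm_exp_inj.
by rewrite -(blk_norm pb bp) -(blk_norm pc cp) bc2.
Qed.

(** One member [c] decides the type: classes are not mixed, and disjointness puts the other centres
    on the line joining [p] to [c.2]. *)
Lemma parallel_class_cases p (S : {set index}) : parallel_class blk p S ->
  S = concentric p \/ exists2 d, d != 0 & S = tangent p d.
Proof.
move=> parS; case/parallel_classP: (parS) => Sp _ cov dis.
have Sat (b : index) : b \in S -> p \in blk b by move/(subsetP Sp); rewrite inE.
have p1p : p + 1 != p by rewrite -subr_eq0 addrAC subrr add0r oner_neq0.
have [c cS _] := cov (p + 1) p1p.
have [cp|cp] := eqVneq c.2 p; [left | right].
  apply: (parallel_class_max parS (parallel_concentric p)).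
  apply/subsetP=> b bS; rewrite inE; apply/negP=> /negP bp.
  exact: parallel_class_not_mixed parS cS bS cp bp.
have d0 : c.2 + p != 0 by rewrite addr_eq0_pchar2.
exists (c.2 + p) => //; apply: (parallel_class_max parS (parallel_tangent p d0)).
apply/subsetP=> b bS; rewrite mem_tangent Sat //=.
have [bp|bp] := eqVneq b.2 p.
  by case: (parallel_class_not_mixed parS bS cS bp cp).
by apply: disjoint_collinear; rewrite ?Sat // => y; apply: dis.
Qed.

Lemma parallel_class_mem_classes p (S : {set index}) :
  parallel_class blk p S <-> S \in cls p.
Proof.
rewrite mem_classes; split; first exact: parallel_class_cases.
by case=> [->|[d d0 ->]]; [apply: parallel_concentric | apply: parallel_tangent].
Qed.

Lemma classes_local_resolution : local_resolution_system blk cls.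
Proof.
move=> p; split; last by move=> S /parallel_class_mem_classes.
apply/and3P; split.
- apply/eqP/setP=> b; apply/bigcupP/idP=> [[S /parallel_class_mem_classes[Sp _ _]]|].
    exact: (subsetP Sp).
  rewrite inE => pb; have [bp|bp] := eqVneq b.2 p.
    by exists (concentric p); rewrite ?inE ?bp //; apply/mem_classes; left.
  have d0 : b.2 + p != 0 by rewrite addr_eq0_pchar2.
  exists (tangent p (b.2 + p)); first by apply/mem_classes; right; exists (b.2 + p).
  by rewrite mem_tangent pb bp collinearxx.
- apply/trivIsetP=> S R /mem_classes hS /mem_classes hR.
  apply: contraR => /pred0Pn[b /andP[/= bS bR]]; apply/eqP.
  case: hS bS => [->|[d d0 ->]]; case: hR bR => [->|[e e0 ->]] //.
  - by rewrite mem_tangent inE => /and3P[_ /negPf ->].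
  - by rewrite mem_tangent inE => /eqP ->; rewrite eqxx andbF.
  rewrite !mem_tangent => /and3P[_ bp be] /and3P[_ _ bd].
  apply: tangent_collinear => //; apply: collinear_trans be.
    by rewrite addr_eq0_pchar2.
  by rewrite collinear_sym.
apply/negP=> /parallel_class_mem_classes/parallel_classP[_ _ cov _].
have [|b] := cov (p + 1); last by rewrite inE.
by rewrite -subr_eq0 addrAC subrr add0r oner_neq0.
Qed.

Lemma local_resolution_unique (Y : F -> {set {set index}}) :
  local_resolution_system blk Y -> forall p, Y p = cls p.
Proof.
move=> resY p; have [partY parY] := resY p.
have [partC _] := classes_local_resolution p.
apply: sub_partition_eq partY partC _; apply/subsetP=> S SY.
by apply/parallel_class_mem_classes/parY.
Qed.

(** * Non-triangularity *)

Definition touching p (b c : index) :=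
  [/\ N (b.2 + p) = N x ^+ b.1, N (c.2 + p) = N x ^+ c.1
    & collinear (b.2 + p) (c.2 + p)].

Lemma touching_sym p (b c : index) : touching p b c -> touching p c b.
Proof. by case=> hb hc bc; split; rewrite // collinear_sym. Qed.

Lemma common_class_cases p (b c : index) : in_common_class cls p b c ->
  (b.2 = p /\ c.2 = p) \/ touching p b c.
Proof.
case=> S /mem_classes[->|[d d0 ->]] /andP[].
  by rewrite !inE => /eqP -> /eqP ->; left.
rewrite !mem_tangent => /and3P[pb bp bd] /and3P[pc cp cd]; right; split.
- exact: blk_norm.
- exact: blk_norm.
by apply: collinear_trans d0 bd _; rewrite collinear_sym.
Qed.

Lemma touching_center_inj p (b c : index) : touching p b c -> b.2 = c.2 -> b = c.
Proof.
move=> [hb hc _] bc; apply: injective_projections => //; apply: norm_exp_inj.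
by rewrite -hb -hc bc.
Qed.

Lemma touching_normD p (b c : index) : touching p b c ->
  N (b.2 + c.2) = N x ^+ b.1 + N x ^+ c.1.
Proof.
case=> <- <- bc; rewrite -collinear_normD //; congr (N _); ring: two0.
Qed.

Lemma touching_point p (b c : index) : touching p b c ->
  (p + b.2) ^+ 2 * (b.2 + c.2) ^+ q = N x ^+ b.1 * (b.2 + c.2).
Proof. by case=> <- _; apply: tangent_point. Qed.

(** Both tangency points satisfy the same equation in the centres and the radius of [d]. Hence
    [p = r], and the radii agree. *)
Lemma touching_concentric p r (b c d : index) : b.2 != d.2 ->
  touching p d b -> touching r d c -> b.2 = c.2 -> b = c.
Proof.
move=> bd tb tc bc; have db0 : d.2 + b.2 != 0.
  by rewrite addr_eq0_pchar2 eq_sym.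
have := touching_point tc; rewrite -bc -(touching_point tb).
move/(mulIf (expf_neq0 q db0))/sqr_inj/addIr => rp.
case: tb tc => _ hb _ [_ hc _]; apply: injective_projections => //.
by apply: norm_exp_inj; rewrite -hb -hc rp bc.
Qed.

(* For three mutually touching blocks, [N (a + b) = N a + N b] for the
   differences [a], [b] of the centres, which forces the centres on a line. *)
Lemma touching_three p p' r (b c d : index) : b.2 != c.2 -> b.2 != d.2 ->
  touching p b c -> touching p' b d -> touching r c d -> p = p'.
Proof.
move=> bc bd tc td tcd.
have a0 : b.2 + c.2 != 0 by rewrite addr_eq0_pchar2.
have e0 : b.2 + d.2 != 0 by rewrite addr_eq0_pchar2.
have col : collinear (b.2 + c.2) (b.2 + d.2).
  rewrite /collinear -addr_eq0_pchar2; apply/eqP.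
  apply: (addrI (N (b.2 + c.2) + N (b.2 + d.2))); rewrite -normD addr0.
  have -> : b.2 + c.2 + (b.2 + d.2) = c.2 + d.2 by ring: two0.
  (* The radius of [b] occurs twice and cancels. *)
  rewrite (touching_normD tc) (touching_normD td) (touching_normD tcd).
  by ring: two0.
have := touching_point tc; have := touching_point td.
move: col a0 e0; set a := b.2 + c.2; set e := b.2 + d.2 => /eqP col a0 e0 h' h.
(* Scaled by [a ^+ q * e], both squares equal the radius of [b] times [a * e]. *)
apply: (addIr b.2); apply: sqr_inj; apply: (@mulIf _ (a ^+ q * e)).
  by rewrite mulf_neq0 ?expf_neq0.
rewrite mulrA h col; transitivity ((p' + b.2) ^+ 2 * e ^+ q * a); last by ring.
by rewrite h'; ring.
Qed.

(** Two concentric pairs give [p = p'] or a touching pair with equal centres. A single one is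
    excluded by [touching_concentric] through the third block, and none by [touching_three]. *)
Lemma classes_non_triangular : non_triangular cls.
Proof.
move=> b c d bc bd cd p p' pp' /common_class_cases hbc /common_class_cases hbd r.
move=> /common_class_cases hcd.
have sep s (e f : index) : e != f -> touching s e f -> e.2 != f.2.
  by move=> ef t; apply: contraNneq ef => /(touching_center_inj t) ->.
case: hbc => [[bp cp]|tbc].
  case: hbd => [[bp' _]|tbd]; first by rewrite -bp -bp' eqxx in pp'.
  have := sep _ _ _ bd tbd; case: hcd => [[cr dr]|tcd] bd2.
    by rewrite bp -cp cr dr eqxx in bd2.
  case/eqP: bc; apply: touching_concentric bd2 (touching_sym tbd) (touching_sym tcd) _.
  by rewrite bp cp.
have bc2 := sep _ _ _ bc tbc.
case: hbd => [[bp' dp']|tbd].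
  case: hcd => [[cr dr]|tcd]; first by rewrite bp' -dp' dr cr eqxx in bc2.
  case/eqP: bd; apply: touching_concentric bc2 (touching_sym tbc) tcd _.
  by rewrite bp' dp'.
have bd2 := sep _ _ _ bd tbd.
case: hcd => [[cr dr]|tcd].
  case/eqP: cd; rewrite eq_sym in bc2; apply: touching_concentric bc2 tbc tbd _.
  by rewrite cr dr.
by case/eqP: pp'; apply: touching_three bc2 bd2 tbc tbd tcd.
Qed.

End NormCircles.

Theorem proposition3p1 (n q : nat) (F : finFieldType) (x : F)
    (hq : q = (2 ^ n)%N) (hq2 : (2 < q)%N) (hF : #|F| = (q ^ 2)%N)
    (hx : primitive_element x) :
  let blk := @sprott F x q.-1 q.+2 in
  let C := fun v : F => members blk (X_ x q v) in
  [/\ local_resolution_system blk C,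
      forall Y : F -> {set {set 'I_q.-1 * F}},
        local_resolution_system blk Y -> forall v : F, Y v = C v
    & non_triangular C].
Proof.
move=> blk C; split.
- exact: classes_local_resolution hq hq2 hF hx.
- by move=> Y resY v; apply: (local_resolution_unique hq hq2 hF hx).
- exact: classes_non_triangular hq hq2 hF hx.
Qed.
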